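(* Let $S$ be an integral domain which is not a field, let $F$ be its field of fractions, and let $A \neq F$ be an $F$-algebra. Let $B$ be an $S$-stable basis of $A$ over $F$. Let $M=\sum_{b \in B} Sb$ and $R=\{x \in A \mid xM \subseteq M\}$. Then $R$ is an $S$-nice subalgebra of $A$.
   Context: Algebras are associative, unital and nonzero, not necessarily commutative, and $A$ may be infinite dimensional over $F$; $F$ is identified with $F\cdot 1_A \subseteq A$. A basis $B$ of $A$ over $F$ is called $S$-stable if there exists a basis $C$ of $A$ over $F$ such that for all $c \in C$ and $b \in B$ one has $cb \in \sum_{y \in B} Sy$. An $S$-subalgebra $R$ of $A$ is called an $S$-nice subalgebra of $A$ if $R \cap F = S$ and $RF = A$, where $RF$ is the $F$-subspace of $A$ spanned by $R$. *)

(* Defs.v *)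
From HB Require Import structures.
From mathcomp Require Import all_boot all_order all_algebra.
From mathcomp Require Import boolp classical_sets.

Set Implicit Arguments.
Unset Strict Implicit.
Unset Printing Implicit Defensive.

Import GRing.Theory.
Local Open Scope classical_set_scope.
Local Open Scope ring_scope.

Section Span.
Variables (F : fieldType) (V : lmodType F).

(* The finite sums \sum k_i v_i with all k_i in K and all v_i in X.  For a
   subring K of F this is the K-submodule of V generated by X; for K = setT it
   is the F-subspace spanned by X. *)
Definition span_over (K : set F) (X : set V) : set V :=
  [set x | exists n (k : 'I_n -> F) (v : 'I_n -> V),
    [/\ forall i, K (k i), forall i, X (v i) & x = \sum_(i < n) k i *: v i]].

Definition lin_indep (X : set V) : Prop :=
  forall n (k : 'I_n -> F) (v : 'I_n -> V),
    injective v -> (forall i, X (v i)) ->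
    \sum_(i < n) k i *: v i = 0 -> forall i, k i = 0.

Definition is_basis (X : set V) : Prop :=
  lin_indep X /\ span_over setT X = setT.

End Span.

(* S sits inside its field of fractions F as the range of tofrac, and F sits
   inside an F-algebra A as the range of in_alg A : k |-> k *: 1. *)
Section Nice.
Variables (S : idomainType) (A : algType {fraction S}).

Definition S_span (X : set A) : set A := span_over (range (@tofrac S)) X.

Definition S_stable (B : set A) : Prop :=
  is_basis B /\
  exists C : set A, is_basis C /\
    forall c b : A, C c -> B b -> S_span B (c * b).

Definition S_subalgebra (R : set A) : Prop :=
  GRing.subring_closed (mem R) /\
  forall (s : S) (x : A), R x -> R (tofrac s *: x).

Definition S_nice (R : set A) : Prop :=
  [/\ S_subalgebra R,
      R `&` range (in_alg A) = [set in_alg A (tofrac s) | s in [set: S]] &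
      span_over setT R = setT].

Definition left_stabilizer (M : set A) : set A :=
  [set x | [set x * m | m in M] `<=` M].

End Nice.

(* Main.v *)
Require Import Defs.
From HB Require Import structures.
From mathcomp Require Import all_boot all_order all_algebra.
From mathcomp Require Import boolp classical_sets.
Import GRing.Theory.
Local Open Scope classical_set_scope.
Local Open Scope ring_scope.

(* Linear independence forces the [b]-coefficient of any expression of [k b] as
   an [S]-combination of [B] to be [k], which gives [R `&` F = S].  Each [c] in
   the basis [C] witnessing stability sends [B], hence [M], into [M]; so [C] is
   contained in [R] and already spans [A] over [F]. *)

Lemma span_over0 {F : fieldType} {V : lmodType F} (K : set F) (X : set V) :
  span_over K X 0.
Proof.
by exists 0, (fun=> 0), (fun=> 0); split=> [[]|[]|] //; rewrite big_ord0.
Qed.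

Lemma span_overD {F : fieldType} {V : lmodType F} (K : set F) (X : set V)
    (x y : V) :
  span_over K X x -> span_over K X y -> span_over K X (x + y).
Proof.
move=> [m [k [v [Kk Xv ->]]]] [n [l [w [Kl Xw ->]]]].
exists (m + n)%N,
  (fun i => match split i with inl j => k j | inr j => l j end),
  (fun i => match split i with inl j => v j | inr j => w j end).
split=> [i|i|]; [by case: (split i)|by case: (split i)|].
rewrite big_split_ord /=; congr (_ + _); apply: eq_bigr => i _.
- by rewrite (unsplitK (inl i)).
- by rewrite (unsplitK (inr i)).
Qed.

Lemma span_over_sum {F : fieldType} {V : lmodType F} (K : set F) (X : set V)
    (n : nat) (f : 'I_n -> V) :
  (forall i, span_over K X (f i)) -> span_over K X (\sum_(i < n) f i).
Proof.
move=> Xf; apply: (big_ind (span_over K X)) => //.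
- exact: span_over0.
- by move=> x y; apply: span_overD.
Qed.

Lemma span_over_gen {F : fieldType} {V : lmodType F} (K : set F) (X : set V)
    (x : V) : K 1 -> X x -> span_over K X x.
Proof.
move=> K1 Xx; exists 1%N, (fun=> 1), (fun=> x); split=> //.
by rewrite big_ord1 scale1r.
Qed.

Lemma span_over_subr {F : fieldType} {V : lmodType F} (K : set F)
    (X Y : set V) : X `<=` Y -> span_over K X `<=` span_over K Y.
Proof.
by move=> XY x [n [k [v [Kk Xv ->]]]]; exists n, k, v; split=> // i; apply: XY.
Qed.

(** Independence in a form where a coefficient is a function of the vector rather than of an index;
    a duplicate-free sequence is enumerated injectively by its positions. *)
Lemma lin_indep_seq {F : fieldType} {V : lmodType F} (X : set V) (s : seq V)
    (f : V -> F) :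
  lin_indep X -> uniq s -> (forall a, a \in s -> X a) ->
  \sum_(a <- s) f a *: a = 0 -> forall a, a \in s -> f a = 0.
Proof.
move=> indX uniq_s Xs sum0 a a_s.
have lt_a : (index a s < size s)%N by rewrite index_mem.
(* The default [0] is never reached, since all positions used are below [size s]. *)
rewrite -(nth_index 0 a_s).
apply: (indX (size s) (fun i => f (nth 0 s i)) (fun i => nth 0 s i) _ _ _
  (Ordinal lt_a)).
- by move=> i j /eqP; rewrite nth_uniq // => /eqP /val_inj.
- by move=> i; apply/Xs/mem_nth.
- by move: sum0; rewrite (big_nth 0) big_mkord.
Qed.

(* The vectors [v i] may repeat, so the coefficient of [b] is the sum of the
   [k i] with [v i = b]. *)
Lemma coef_lin_indep {F : fieldType} {V : lmodType F} (X : set V) (b : V)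
    (c : F) (n : nat) (k : 'I_n -> F) (v : 'I_n -> V) :
  lin_indep X -> X b -> (forall i, X (v i)) ->
  c *: b = \sum_(i < n) k i *: v i -> c = \sum_(i < n | v i == b) k i.
Proof.
move=> indX Xb Xv def_cb.
(* [b] is added because it may differ from every [v i]; the claim is then that [c] equals an empty
   sum. *)
set s := undup (b :: codom v).
have b_s : b \in s by rewrite mem_undup mem_head.
have v_s i : v i \in s by rewrite mem_undup inE codom_f orbT.
(* [f a] is the coefficient of [a] in the difference between the given combination and [c *: b],
   once equal vectors are collected. *)
pose f a := \sum_(i < n | v i == a) k i - (if a == b then c else 0).
suff /eqP : f b = 0 by rewrite /f eqxx subr_eq0 => /eqP.
apply: (lin_indep_seq X s f) => //; first exact: undup_uniq.
  move=> a; rewrite mem_undup inE => /orP[/eqP-> //|/codomP[i ->]].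
  exact: Xv.
under eq_bigr do rewrite scalerBl.
rewrite sumrB; apply/eqP; rewrite subr_eq0; apply/eqP; transitivity (c *: b).
  rewrite def_cb; under eq_bigr do rewrite scaler_suml big_mkcond /=.
  (* After the exchange, index [i] contributes only at the single entry [a = v i] of [s]. *)
  rewrite exchange_big /=; apply: eq_bigr => i _.
  rewrite (bigD1_seq (v i)) ?undup_uniq //= eqxx big1 ?addr0 // => a.
  by rewrite eq_sym => /negPf->.
rewrite (bigD1_seq b) ?undup_uniq //= eqxx big1 ?addr0 // => a /negPf->.
by rewrite scale0r.
Qed.

(** An empty set spans only 0, whereas [1 != 0] in [A]. The element obtained serves as a test vector
    for the scalars in the stabilizer. *)
Lemma is_basis_nonempty {F : fieldType} {A : algType F} (B : set A) :
  is_basis B -> exists b, B b.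
Proof.
move=> [_ spanB]; have [n [k [v [_ Bv]]]] : span_over setT B 1 by rewrite spanB.
case: n k v Bv => [|n] k v Bv; last by exists (v ord0).
by rewrite big_ord0 => /eqP; rewrite oner_eq0.
Qed.

Section LeftStabilizer.
Variables (S : idomainType) (A : algType {fraction S}).

Lemma S_spanZ (X : set A) (s : S) (x : A) :
  S_span X x -> S_span X (tofrac s *: x).
Proof.
move=> [n [k [v [Sk Xv ->]]]].
exists n, (fun i => tofrac s * k i), v; split=> // [i|].
  by have [t _ <-] := Sk i; exists (s * t); rewrite // rmorphM.
by rewrite scaler_sumr; apply: eq_bigr => i _; rewrite scalerA.
Qed.

Lemma S_spanB (X : set A) (x y : A) :
  S_span X x -> S_span X y -> S_span X (x - y).
Proof.
move=> Xx Xy; apply: span_overD => //.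
(* Subtraction reduces to scaling by an element of [S], because -1 in the fraction field is the
   image of -1 in [S]. *)
by rewrite -scaleN1r -[-1](rmorphN1 (@tofrac S)); apply: S_spanZ.
Qed.

Lemma left_stabilizerP (M : set A) (x : A) :
  left_stabilizer M x <-> forall m, M m -> M (x * m).
Proof.
split=> [Rx m Mm|Mx _ [m Mm <-]]; last exact: Mx.
by apply: Rx; exists m.
Qed.

(** Left multiplication by [x] is additive and commutes with scalars, so stability can be tested on
    generators. This is what turns the condition on [C] and [B] into membership of [C] in the
    stabilizer. *)
Lemma left_stabilizer_S_span_gen (X : set A) (x : A) :
  (forall b, X b -> S_span X (x * b)) -> left_stabilizer (S_span X) x.
Proof.
move=> xX; apply/left_stabilizerP => _ [n [k [v [Sk Xv ->]]]].
rewrite mulr_sumr; apply: span_over_sum => i.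
by have [s _ <-] := Sk i; rewrite -scalerAr; apply/S_spanZ/xX.
Qed.

Lemma left_stabilizer_S_subalgebra (X : set A) :
  S_subalgebra (left_stabilizer (S_span X)).
Proof.
split; last first.
  move=> s x /left_stabilizerP Rx; apply/left_stabilizerP => m Mm.
  by rewrite -scalerAl; apply/S_spanZ/Rx.
split=> [|x y|x y].
- by apply/mem_set/left_stabilizerP => m; rewrite mul1r.
- move=> /set_mem/left_stabilizerP Rx /set_mem/left_stabilizerP Ry.
  apply/mem_set/left_stabilizerP => m Mm.
  by rewrite mulrBl; apply: S_spanB; [apply: Rx|apply: Ry].
- move=> /set_mem/left_stabilizerP Rx /set_mem/left_stabilizerP Ry.
  apply/mem_set/left_stabilizerP => m Mm.
  by rewrite -mulrA; apply/Rx/Ry.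
Qed.

Lemma left_stabilizer_scalars (B : set A) : is_basis B ->
  left_stabilizer (S_span B) `&` range (in_alg A) =
  [set in_alg A (tofrac s) | s in [set: S]].
Proof.
move=> basB; have [b Bb] := is_basis_nonempty B basB.
have Mb : S_span B b.
  by apply: span_over_gen => //; exists 1; rewrite ?rmorph1.
apply/seteqP; split=> x.
  move=> [/left_stabilizerP Rx [k _ def_x]].
  (* Applying [x = k *: 1] to the basis vector [b] puts [k *: b] in the [S]-span of [B]. Comparing
     coefficients at [b] makes [k] a finite sum of elements of [S]. *)
  move: (Rx b Mb); rewrite -def_x /= mulr_algl => -[n [l [v [Sl Bv def_kb]]]].
  suff [s _ <-] : range (@tofrac S) k by exists s.
  rewrite (coef_lin_indep B b k n l v basB.1 Bb Bv def_kb).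
  apply: (big_ind (range (@tofrac S))) => //.
  by move=> _ _ [s _ <-] [t _ <-]; exists (s + t); rewrite ?tofracD.
move=> [s _ <-]; split; last by exists (tofrac s).
by apply/left_stabilizerP => m Mm; rewrite /= mulr_algl; apply: S_spanZ.
Qed.

End LeftStabilizer.

Theorem theorem3p13 (S : idomainType) (hS : ~ GRing.field_axiom S)
    (A : algType {fraction S}) (hA : range (in_alg A) <> [set: A])
    (B : set A) (hB : S_stable B) :
  S_nice (left_stabilizer (S_span B)).
Proof.
have [basB [C [[_ spanC] CB]]] := hB; split.
- exact: left_stabilizer_S_subalgebra.
- exact: left_stabilizer_scalars.
(* Only the inclusion of the whole algebra in the span needs proof; writing the algebra as the span
   of [C] reduces it to [C] lying in the stabilizer. *)
- apply/seteqP; split=> //; rewrite -spanC; apply: span_over_subr => c Cc.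
  by apply: left_stabilizer_S_span_gen => b; apply: CB.
Qed.
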